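(* Let $a,b>0$, $0\leq v\leq 1$, and let $N$ be a nonnegative integer. Then $$(1-v)a+vb\ \geq\ a^{1-v}b^{v}+\sum_{n=0}^{N-1}r_{n}(v)\sum_{k=1}^{2^{n}}g_{n,k}(a,b)\,\chi_{\left(\frac{k-1}{2^{n}},\frac{k}{2^{n}}\right)}(v)+\left(\frac{v(1-v)}{2}-\sum_{n=0}^{N-1}\frac{r_{n}(v)}{2^{n+2}}\right)\left(\ln\frac{b}{a}\right)^{2}\min\{a,b\}$$ and $$(1-v)a+vb\ \leq\ a+b-a^{v}b^{1-v}-\sum_{n=0}^{N-1}r_{n}(v)\sum_{k=1}^{2^{n}}g_{n,k}(b,a)\,\chi_{\left(\frac{k-1}{2^{n}},\frac{k}{2^{n}}\right)}(v)-\left(\frac{v(1-v)}{2}-\sum_{n=0}^{N-1}\frac{r_{n}(v)}{2^{n+2}}\right)\left(\ln\frac{b}{a}\right)^{2}\min\{a,b\}.$$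
   Context: The functions $r_n:[0,1]\to\mathbb{R}$ are defined recursively by $r_0(v)=\min\{v,1-v\}$ and $r_n(v)=\min\{2r_{n-1}(v),1-2r_{n-1}(v)\}$ for $n\ge 1$. For $a,b>0$, $$g_{n,k}(a,b)=a^{1-(k-1)/2^{n}}b^{(k-1)/2^{n}}+a^{1-k/2^{n}}b^{k/2^{n}}-2a^{1-(2k-1)/2^{n+1}}b^{(2k-1)/2^{n+1}}.$$ $\chi_I$ is the characteristic function of the interval $I$. A sum $\sum_{n=0}^{N-1}$ is zero when $N=0$. *)

(* Defs.v *)
From mathcomp Require Import all_boot all_order all_algebra.
From mathcomp Require Import all_classical all_reals all_analysis.

Set Implicit Arguments.
Unset Strict Implicit.
Unset Printing Implicit Defensive.

Import Order.TTheory GRing.Theory Num.Theory.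

Local Open Scope ring_scope.

(* The r_n are defined on all of R; only their values on [0, 1] are used. *)
Fixpoint r (R : realType) (n : nat) (v : R) : R :=
  match n with
  | 0%N => Num.min v (1 - v)
  | m.+1 => Num.min (2 * r m v) (1 - 2 * r m v)
  end.

Definition g (R : realType) (n k : nat) (a b : R) : R :=
  a `^ (1 - (k%:R - 1) / 2 ^+ n) * b `^ ((k%:R - 1) / 2 ^+ n)
  + a `^ (1 - k%:R / 2 ^+ n) * b `^ (k%:R / 2 ^+ n)
  - 2 * (a `^ (1 - (2 * k%:R - 1) / 2 ^+ n.+1)
         * b `^ ((2 * k%:R - 1) / 2 ^+ n.+1)).

(* Main.v *)
Require Import Defs.
From mathcomp Require Import all_boot all_order all_algebra.
From mathcomp Require Import all_classical all_reals all_analysis.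
From mathcomp Require Import ring lra zify.

Import Order.TTheory GRing.Theory Num.Theory.

Local Open Scope classical_set_scope.
Local Open Scope ring_scope.

(** The weighted geometric mean x |-> a^(1-x) b^x is the exponential of an affine
    function with slope L = ln (b / a), and both inequalities compare it with
    its chord over [0, 1], whose value at v is the weighted arithmetic mean.

    The function r_n v is the distance from 2^n v to the nearest integer, so
    on each dyadic cell of length 2^-n it is a tent, and the double sum of the
    theorem is a partial sum of the Faber-Schauder series.  Refining the dyadic
    interpolation of a function h from level n to level n+1 moves, in each cell,
    the value at the midpoint down by half of the second difference
    h(left) + h(right) - 2 h(mid), hence the value at v by r_n v times that
    second difference.  Summing over the levels below N, the chord minus the
    partial sum is exactly the piecewise linear interpolation of h on the
    dyadic cells of level N ([faber_schauder_partial_sum]).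

    It remains to bound an interpolation from below.  On [0, 1] the second
    derivative of the geometric mean is at least L^2 min(a, b), so it is
    strongly convex ([expR_affine_strongly_convex]), and its interpolation
    exceeds its value at v by at least (L^2 min(a, b) / 2) times the same
    excess for the function x^2.  By the partial sum identity for x^2, that
    excess is v (1 - v) - 2 \sum_n r_n v / 4^(n+1), and it is enough that
    4^-(n+1) <= 2^-(n+2) ([sum_gap_sqr_le]).

    The second inequality is the first one with a and b exchanged, subtracted
    from a + b. *)

(** * Dyadic cells and the tent functions *)

(** Cells are closed, so that every v of [0, 1] lies in a cell at each level; a
    dyadic v may lie in two of them, where all formulas below agree. *)
Definition in_cell {R : realType} (n k : nat) (v : R) : Prop :=
  (k < 2 ^ n)%N /\ k%:R <= 2 ^+ n * v <= k.+1%:R.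

(** The second difference of [h] on the cell whose right end is k / 2^n; for the
    geometric mean it is [g n k a b]. *)
Definition gap {R : realType} (h : R -> R) (n k : nat) : R :=
  h ((k%:R - 1) / 2 ^+ n) + h (k%:R / 2 ^+ n)
  - 2 * h ((2 * k%:R - 1) / 2 ^+ n.+1).

Lemma in_cell_parent {R : realType} {n k : nat} {v : R} :
  in_cell n.+1 k v ->
  exists j (b : bool), k = (b + j.*2)%N /\ in_cell n j v.
Proof.
move=> [k_lt]; rewrite -[in k%:R](odd_double_half k).
rewrite -[in k.+1%:R](odd_double_half k) => /andP[lo hi].
exists k./2, (odd k); split; first by rewrite odd_double_half.
split; first by rewrite expnS in k_lt; lia.
move: lo hi; rewrite exprS -natr1 -natr1 natrD -mul2n natrM.
by case: (odd k) => /= lo hi; apply/andP; split; lra.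
Qed.

Lemma in_cell_exists {R : realType} (n : nat) {v : R} :
  0 <= v -> v <= 1 -> exists k, in_cell n k v.
Proof.
move=> v0 v1; elim: n => [|n [j [j_lt /andP[lo hi]]]].
  by exists 0%N; split => //; rewrite expr0 mul1r v0.
have [h|h] := leP (2 ^+ n.+1 * v) (2 * j%:R + 1).
  exists j.*2; split; first by rewrite expnS; lia.
  by move: h; rewrite exprS -natr1 -mul2n natrM => h; apply/andP; split; lra.
exists j.*2.+1; split; first by rewrite expnS; lia.
move: hi h; rewrite exprS -!natr1 -mul2n natrM => hi h.
by apply/andP; split; lra.
Qed.

(** The recursion for [r] folds the doubled tent of a cell at height 1/2, which
    gives one tent on each half of the cell. *)
Lemma r_in_cell {R : realType} {n k : nat} {v : R} : in_cell n k v ->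
  r n v = Num.min (2 ^+ n * v - k%:R) (k.+1%:R - 2 ^+ n * v).
Proof.
elim: n k => [|n IHn] k kv.
  have [] := kv; rewrite expn0 ltnS leqn0 => /eqP -> _.
  by rewrite expr0 mul1r subr0.
have [j [b [kE jv]]] := in_cell_parent kv.
rewrite /= (IHn _ jv); have [_ /andP[]] := jv; have [_ /andP[]] := kv.
rewrite kE exprS -[j.+1%:R]natr1 -[(b + _).+1%:R]natr1 natrD -mul2n natrM -mulrA.
set x := 2 ^+ n * v; case: b {kE} => /= lo hi lo' hi'.
all: by case: (leP (x - j%:R) (j%:R + 1 - x)) => ?; do 2?case: leP => ?; lra.
Qed.

Lemma r_ge0 {R : realType} (n : nat) {v : R} : 0 <= v -> v <= 1 -> 0 <= r n v.
Proof.
move=> v0 v1; have [k kv] := in_cell_exists n v0 v1.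
by have [_ /andP[]] := kv; rewrite (r_in_cell kv) le_min !subr_ge0 => -> ->.
Qed.

(** Only the open cell around v contributes to the sum.  When v is an end of its
    cell no indicator equals 1, but there the tent function vanishes. *)
Lemma sum_indic_cells {R : realType} {n k : nat} {v : R} (F : nat -> R) :
  in_cell n k v ->
  r n v * (\sum_(1 <= i < (2 ^ n).+1)
    F i * \1_(`](i%:R - 1) / 2 ^+ n, i%:R / 2 ^+ n[%classic) v)
  = r n v * F k.+1.
Proof.
move=> kv; have [k_lt /andP[lo hi]] := kv.
have p0 : 0 < 2 ^+ n :> R by rewrite exprn_gt0.
have indE i : \1_(`](i%:R - 1) / 2 ^+ n, i%:R / 2 ^+ n[%classic) v
    = (i%:R - 1 < 2 ^+ n * v < i%:R)%R%:R :> R.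
  by rewrite indicE mem_setE in_itv /= ltr_pdivrMr// ltr_pdivlMr// [v * _]mulrC.
under eq_bigr do rewrite indE.
have [r0|r_neq0] := eqVneq (r n v) 0; first by rewrite r0 !mul0r.
have /andP[lo' hi'] : k%:R < 2 ^+ n * v < k.+1%:R.
  rewrite !lt_neqAle lo hi !andbT; apply/andP; split.
    apply: contraNneq r_neq0 => e.
    by rewrite (r_in_cell kv) -e subrr min_l // e subr_ge0.
  apply: contraNneq r_neq0 => e.
  by rewrite (r_in_cell kv) e subrr min_r // -e subr_ge0.
congr (_ * _); rewrite (bigD1_seq k.+1) ?iota_uniq ?mem_index_iota //=.
rewrite -natr1 addrK lo' natr1 hi' mulr1 big1_seq ?addr0// => i.
rewrite mem_index_iota => /andP[i_neq /andP[i_gt0 _]].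
suff -> : (i%:R - 1 < 2 ^+ n * v < i%:R) = false by rewrite mulr0.
apply/negP => /andP[i_lo i_hi].
have : k%:R < i%:R :> R by exact: lt_trans lo' i_hi.
have : i%:R < k.+2%:R :> R.
  by rewrite -[k.+2]addn1 natrD -ltrBlDr; exact: lt_trans i_lo hi'.
by rewrite !ltr_nat => ? ?; move/eqP: i_neq; lia.
Qed.

(** * Partial sums of the Faber-Schauder series *)

(** One more level replaces the interpolation on a cell by the one on the half
    containing v: the values at the ends are kept, and the tent function is the
    weight of the midpoint up to a factor 2. *)
Lemma faber_schauder_partial_sum {R : realType} (h : R -> R) {N k : nat}
    {v : R} : in_cell N k v ->
  (1 - v) * h 0 + v * h 1
  - \sum_(0 <= n < N) (r n v * \sum_(1 <= i < (2 ^ n).+1)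
      gap h n i * \1_(`](i%:R - 1) / 2 ^+ n, i%:R / 2 ^+ n[%classic) v)
  = (k.+1%:R - 2 ^+ N * v) * h (k%:R / 2 ^+ N)
    + (2 ^+ N * v - k%:R) * h (k.+1%:R / 2 ^+ N).
Proof.
elim: N k => [|N IHN] k kv.
  have [] := kv; rewrite expn0 ltnS leqn0 => /eqP -> _.
  by rewrite big_geq// subr0 expr0 !divr1 mul1r subr0.
have [j [b [kE jv]]] := in_cell_parent kv.
rewrite big_nat_recr//= opprD addrA (IHN _ jv) (sum_indic_cells _ jv).
rewrite (r_in_cell jv) /gap.
have [_ /andP[]] := kv.
(* Express all nodes with denominator 2^(N+1): the parent cell [j, j+1] is
   [2j, 2j+2] there, with midpoint 2j+1. *)
have halfE (y : R) : y / 2 ^+ N = (2 * y) / 2 ^+ N.+1.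
  by rewrite exprS -mulf_div divff ?mul1r// pnatr_eq0.
have midE : 2 * (j%:R + 1) - 1 = 1 + 2 * j%:R :> R by ring.
have endE : 1 + 2 * j%:R + 1 = 2 * (j%:R + 1) :> R by ring.
rewrite kE !halfE -[j.+1%:R]natr1 -[(b + _).+1%:R]natr1 natrD -mul2n natrM.
rewrite addrK midE.
case: b {kE} => /=; rewrite ?endE ?add0r ?[2 * j%:R + 1]addrC => lo hi.
all: rewrite exprS -mulrA in lo hi *; set x := 2 ^+ N * v in lo hi *.
  by rewrite min_r; [ring | lra].
by rewrite min_l; [ring | lra].
Qed.
(** * Strong convexity of the exponential *)

Lemma ge0_derive_ge0 {R : realType} (f df : R -> R) :
  f 0 = 0 -> (forall x : R, is_derive x 1 f (df x)) ->
  (forall x, 0 < x -> 0 <= df x) -> forall u, 0 <= u -> 0 <= f u.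
Proof.
move=> f0 fD df_ge0 u u0; rewrite -f0.
have fdrv (x : R) : derivable f x 1 by have [] := fD x.
apply: (@ger0_derive1_ndecr R f 0 u) => //.
  move=> x; rewrite in_itv/= => /andP[x0 _].
  by rewrite derive1E (@derive_val _ _ _ _ _ _ _ (fD x)) df_ge0.
exact: derivable_within_continuous.
Qed.

Lemma expR_ge_quadratic {R : realType} {u : R} :
  0 <= u -> 1 + u + u ^+ 2 / 2 <= expR u.
Proof.
move=> u0; rewrite -subr_ge0.
apply: (@ge0_derive_ge0 R (fun x => expR x - (1 + x + x ^+ 2 / 2))
          (fun x => expR x - (1 + x))) u0.
- by rewrite expR0 expr0n mul0r !addr0 subrr.
- move=> x; apply: is_derive_eq.
  by rewrite !scaler0 /GRing.scale/=; field.
- by move=> x _; rewrite subr_ge0 expR_ge1Dx.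
Qed.

Lemma expR_backward_quadratic {R : realType} {w : R} :
  0 <= w -> w ^+ 2 / 2 <= 1 - (1 - w) * expR w.
Proof.
move=> w0; rewrite -subr_ge0.
apply: (@ge0_derive_ge0 R (fun x => 1 - (1 - x) * expR x - x ^+ 2 / 2)
          (fun x => x * (expR x - 1))) w0.
- by rewrite expR0 expr0n mul0r !subr0 mul1r subrr.
- move=> x; apply: is_derive_eq.
  by rewrite !scaler0 /GRing.scale/=; field.
- move=> x x0; rewrite mulr_ge0 ?ltW// subr_gt0.
  by rewrite expR_gt1.
Qed.

(** Taylor's formula with a second-order remainder: m bounds exp at both ends,
    hence between them.  The smaller end is x if x <= y, and y otherwise, which
    is why expansions in both directions are needed. *)
Lemma expR_tangent {R : realType} {m x y : R} :
  m <= expR x -> m <= expR y ->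
  expR x + expR x * (y - x) + m * (y - x) ^+ 2 / 2 <= expR y.
Proof.
move=> mx my; have [u0|/ltW] := leP 0 (y - x).
  have yE : expR y = expR (y - x) * expR x by rewrite -expRD subrK.
  have := ler_wpM2r (expR_ge0 x) (expR_ge_quadratic u0); rewrite -yE.
  have := ler_wpM2r (sqr_ge0 (y - x)) mx; lra.
rewrite -oppr_ge0 opprB => w0.
have xE : expR x = expR (x - y) * expR y by rewrite -expRD subrK.
have := ler_wpM2r (expR_ge0 y) (expR_backward_quadratic w0).
rewrite [in X in _ <= X]mulrBl -[X in _ <= _ - X]mulrA -xE.
have := ler_wpM2r (sqr_ge0 (x - y)) my; lra.
Qed.

(** Average, with weights p and q, the tangent inequalities at the barycentre:
    the linear terms cancel and the quadratic ones leave the variance. *)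
Lemma expR_affine_strongly_convex {R : realType} (al L m p q s t : R) :
  0 <= p -> 0 <= q -> p + q = 1 ->
  m <= expR (al + L * s) -> m <= expR (al + L * t) ->
  m <= expR (al + L * (p * s + q * t)) ->
  expR (al + L * (p * s + q * t))
    + m * L ^+ 2 / 2 * (p * s ^+ 2 + q * t ^+ 2 - (p * s + q * t) ^+ 2)
  <= p * expR (al + L * s) + q * expR (al + L * t).
Proof.
move=> p0 q0 pq ms mt mx; set x := p * s + q * t.
have hs := ler_wpM2l p0 (expR_tangent mx ms).
have ht := ler_wpM2l q0 (expR_tangent mx mt).
apply: le_trans (lerD hs ht); rewrite -/x le_eqVlt; apply/orP; left; apply/eqP.
rewrite /x (_ : q = 1 - p); last by rewrite -pq; ring.
by field.
Qed.

(** * The quadratic correction *)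

Lemma gap_sqr {R : realType} (n i : nat) :
  gap (fun x : R => x ^+ 2) n i = 2 / (2 ^+ n.+1) ^+ 2.
Proof.
rewrite /gap [2 ^+ n.+1]exprS.
have : 2 ^+ n != 0 :> R by rewrite expf_neq0// pnatr_eq0.
by move: (2 ^+ n) => p p_neq0; field.
Qed.

(** Level n contributes exactly 2 r_n v / 4^(n+1), whence the bound. *)
Lemma sum_gap_sqr_le {R : realType} (N : nat) {v : R} : 0 <= v -> v <= 1 ->
  \sum_(0 <= n < N) (r n v * \sum_(1 <= i < (2 ^ n).+1)
      gap (fun x : R => x ^+ 2) n i
      * \1_(`](i%:R - 1) / 2 ^+ n, i%:R / 2 ^+ n[%classic) v)
  <= 2 * \sum_(0 <= n < N) r n v / 2 ^+ n.+2.
Proof.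
move=> v0 v1; rewrite mulr_sumr; apply: ler_sum => n _.
have [k kv] := in_cell_exists n v0 v1.
rewrite (sum_indic_cells _ kv) gap_sqr mulrCA ler_pM2l//.
rewrite ler_wpM2l ?r_ge0// -exprM lef_pV2 ?posrE ?exprn_gt0//.
by rewrite ler_eXn2l ?ltr1n//; lia.
Qed.

(** * Refined Young inequalities *)

Lemma powR_geodesic {R : realType} {a b : R} (x : R) : 0 < a -> 0 < b ->
  a `^ (1 - x) * b `^ x = expR (ln a + ln (b / a) * x).
Proof.
move=> a0 b0; rewrite /powR !gt_eqF// -expRD ln_div ?posrE//.
by congr expR; ring.
Qed.

(** The exponent is affine, so on [0, 1] it stays between ln a and ln b. *)
Lemma min_le_geodesic {R : realType} {a b : R} (x : R) : 0 < a -> 0 < b ->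
  0 <= x <= 1 -> Num.min a b <= expR (ln a + ln (b / a) * x).
Proof.
move=> a0 b0 /andP[x0 x1]; rewrite ln_div ?posrE//.
have [ab|/ltW ba] := leP a b.
  rewrite -[leLHS]lnK ?posrE// ler_expR lerDl mulr_ge0// subr_ge0.
  by rewrite ler_ln ?posrE.
rewrite -[leLHS]lnK ?posrE// ler_expR.
have : ln b <= ln a by rewrite ler_ln ?posrE.
nra.
Qed.

Lemma young_multiterm_refinement {R : realType} (a b v : R) (N : nat) :
  0 < a -> 0 < b -> 0 <= v -> v <= 1 ->
  a `^ (1 - v) * b `^ v
  + \sum_(0 <= n < N) (r n v *
      \sum_(1 <= k < (2 ^ n).+1)
        g n k a b * \1_(`](k%:R - 1) / 2 ^+ n, k%:R / 2 ^+ n[%classic) v)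
  + (v * (1 - v) / 2 - \sum_(0 <= n < N) r n v / 2 ^+ n.+2)
    * ln (b / a) ^+ 2 * Num.min a b
  <= (1 - v) * a + v * b.
Proof.
move=> a0 b0 v0 v1.
set m := Num.min a b; set L := ln (b / a).
pose f x := expR (ln a + L * x).
have gE n k : g n k a b = gap f n k by rewrite /g /gap !powR_geodesic.
under eq_bigr do under eq_bigr do rewrite gE.
have f0 : f 0 = a by rewrite /f mulr0 addr0 lnK.
have f1 : f 1 = b.
  by rewrite /f mulr1 /L ln_div ?posrE// addrC subrK lnK.
have [k kv] := in_cell_exists N v0 v1.
have := faber_schauder_partial_sum f kv; rewrite f0 f1.
have := faber_schauder_partial_sum (fun x => x ^+ 2) kv.
rewrite powR_geodesic// -/L -/(f v).
have := sum_gap_sqr_le N v0 v1.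
set Sf := \sum_(0 <= n < N) _; set Sq := \sum_(0 <= n < N) _.
set Sr := \sum_(0 <= n < N) _ => SqSr.
have [k_lt /andP[lo hi]] := kv.
have P0 : 0 < 2 ^+ N :> R by rewrite exprn_gt0.
(* p and q are the barycentric coordinates of v in the cell [s, t]. *)
set p := k.+1%:R - _; set q := _ * v - _.
set s := k%:R / _; set t := k.+1%:R / _ => sqE fE.
have xE : p * s + q * t = v.
  by rewrite /p /q /s /t -natr1; field; rewrite lt0r_neq0.
have kP : k.+1%:R <= 2 ^+ N :> R by rewrite -natrX ler_nat.
have s01 : 0 <= s <= 1.
  rewrite /s divr_ge0 ?(ltW P0)//= ler_pdivrMr// mul1r.
  by rewrite (le_trans _ kP)// ler_nat.
have t01 : 0 <= t <= 1 by rewrite /t divr_ge0 ?(ltW P0)//= ler_pdivrMr// mul1r.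
have := @expR_affine_strongly_convex R (ln a) L m p q s t.
rewrite xE -!/(f _) !min_le_geodesic ?v0// /p /q !subr_ge0 -!/p -!/q.
have pq : p + q = 1 by rewrite /p /q -natr1; ring.
move=> /(_ hi lo pq isT isT isT); rewrite -fE -sqE.
have mL_ge0 : 0 <= m * L ^+ 2 by rewrite mulr_ge0 ?sqr_ge0// le_min !ltW.
have := ler_wpM2l mL_ge0 SqSr.
lra.
Qed.

Theorem theorem7 (R : realType) (a b v : R) (N : nat)
    (ha : 0 < a) (hb : 0 < b) (hv0 : 0 <= v) (hv1 : v <= 1) :
  (1 - v) * a + v * b >=
    a `^ (1 - v) * b `^ v
    + \sum_(0 <= n < N) (r n v *
        \sum_(1 <= k < (2 ^ n).+1)
          g n k a b * \1_(`](k%:R - 1) / 2 ^+ n, k%:R / 2 ^+ n[%classic) v)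
    + (v * (1 - v) / 2 - \sum_(0 <= n < N) r n v / 2 ^+ n.+2)
      * ln (b / a) ^+ 2 * Num.min a b
  /\
  (1 - v) * a + v * b <=
    a + b - a `^ v * b `^ (1 - v)
    - \sum_(0 <= n < N) (r n v *
        \sum_(1 <= k < (2 ^ n).+1)
          g n k b a * \1_(`](k%:R - 1) / 2 ^+ n, k%:R / 2 ^+ n[%classic) v)
    - (v * (1 - v) / 2 - \sum_(0 <= n < N) r n v / 2 ^+ n.+2)
      * ln (b / a) ^+ 2 * Num.min a b.
Proof.
split; first exact: young_multiterm_refinement.
have := @young_multiterm_refinement R b a v N hb ha hv0 hv1.
have -> : ln (a / b) ^+ 2 = ln (b / a) ^+ 2.
  by rewrite !ln_div ?posrE// -[RHS]sqrrN opprB.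
rewrite minC [b `^ _ * _]mulrC; lra.
Qed.
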